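(* There is an algorithm that, given a sequence $A=\langle a_1,\ldots,a_n\rangle$ of $n\ge 0$ real numbers and a real number $x$, computes an insertion index $p^*\in\{0,1,\ldots,n\}$ minimizing $\mathrm{value}(A\oplus_{p^*} x)$ over all insertion indices, using $O(n)$ time and $O(n)$ space.
   Context: For a sequence $A=\langle a_1,\ldots,a_n\rangle$ of reals and indices $0\le i\le j\le n$, $A_i^j$ denotes the empty sequence if $i=j$ and the contiguous subsequence $\langle a_{i+1},\ldots,a_j\rangle$ otherwise. The score of a sequence is the sum of its elements (the empty sequence has score $0$). $\mathrm{value}(A)$ is the maximum score of a contiguous subsequence $A_i^j$ of $A$ (including the empty one). For $p\in\{0,\ldots,n\}$, $A\oplus_p x=\langle a_1,\ldots,a_p,x,a_{p+1},\ldots,a_n\rangle$ is the sequence obtained by inserting $x$ at insertion index $p$. (This is the Insertion in a Sequence with Scores problem.) *)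

(* Defs.v *)
From mathcomp Require Import all_boot all_order all_algebra.
From mathcomp Require Import reals.

Set Implicit Arguments.
Unset Strict Implicit.
Unset Printing Implicit Defensive.

Import Order.TTheory GRing.Theory Num.Theory.

Local Open Scope ring_scope.

Section Sequences.
Variable R : realFieldType.
Implicit Types (A : seq R) (x : R) (i j p : nat).

Definition score A : R := \sum_(a <- A) a.

(* With 1-based entries, this is <a_(i+1), ..., a_j> (empty when i = j). *)
Definition subsequence A i j : seq R := take (j - i) (drop i A).

(* The default element 0 of the iterated maximum is itself attained, as the
   score of the empty subsequence. *)
Definition value A : R :=
  \big[Num.max/0]_(0 <= i < (size A).+1)
    \big[Num.max/0]_(i <= j < (size A).+1) score (subsequence A i j).

Definition insertion A p x : seq R := take p A ++ x :: drop p A.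

(* For p ranging over the insertion indices 0, ..., size A. *)
Definition optimal_insertion_index A x p : Prop :=
  (p <= size A)%N /\
  forall q, (q <= size A)%N ->
    value (insertion A p x) <= value (insertion A q x).

End Sequences.

(* Algorithms are programs of a real RAM: a random access machine that handles
   natural numbers ("words") and exact real numbers separately. There are word
   registers and real registers, accessed directly, and a word memory and a
   real memory, addressed by the contents of a word register. Programs do not
   depend on the input, and the only real constants they mention are integers.
   Every instruction takes unit time; there is no conversion from reals to
   words. *)

Inductive word_op := WAdd | WSub | WMul | WDiv.
Inductive real_op := RAdd | RSub | RMul | RDiv.

(* d: destination register; a, b: source registers; l: jump target. *)
Inductive instr :=
  | WConst (d k : nat)              (* w_d := k *)
  | WMove (d a : nat)               (* w_d := w_a *)
  | WArith (o : word_op) (d a b : nat)   (* w_d := w_a o w_b *)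
  | WLoad (d a : nat)               (* w_d := wmem[w_a] *)
  | WStore (a b : nat)              (* wmem[w_a] := w_b *)
  | RConst (d : nat) (z : int)      (* r_d := z *)
  | RMove (d a : nat)               (* r_d := r_a *)
  | RArith (o : real_op) (d a b : nat)   (* r_d := r_a o r_b *)
  | RLoad (d a : nat)               (* r_d := rmem[w_a] *)
  | RStore (a b : nat)              (* rmem[w_a] := r_b *)
  | Jump (l : nat)
  | WJumpLe (a b l : nat)           (* if w_a <= w_b goto l *)
  | RJumpLe (a b l : nat)           (* if r_a <= r_b goto l *)
  | Halt.

Definition program := seq instr.

(* Subtraction is truncated at 0; division is Euclidean. *)
Definition word_arith (o : word_op) : nat -> nat -> nat :=
  match o with
  | WAdd => addn | WSub => subn | WMul => muln | WDiv => divn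
  end.

Section Machine.
Variable R : realFieldType.

Definition real_arith (o : real_op) (a b : R) : R :=
  match o with
  | RAdd => a + b | RSub => a - b | RMul => a * b | RDiv => a / b
  end.

Record state := State {
  pc : nat;
  wreg : nat -> nat;
  rreg : nat -> R;
  wmem : nat -> nat;
  rmem : nat -> R
}.

Implicit Types (P : program) (c : state) (s t : nat).

Definition goto c l := State l (wreg c) (rreg c) (wmem c) (rmem c).

Definition set_wreg c d v :=
  State (pc c).+1 [eta wreg c with d |-> v] (rreg c) (wmem c) (rmem c).

Definition set_rreg c d v :=
  State (pc c).+1 (wreg c) [eta rreg c with d |-> v] (wmem c) (rmem c).

Definition set_wmem c i v :=
  State (pc c).+1 (wreg c) (rreg c) [eta wmem c with i |-> v] (rmem c).

Definition set_rmem c i v :=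
  State (pc c).+1 (wreg c) (rreg c) (wmem c) [eta rmem c with i |-> v].

Definition guard (b : bool) c : option state := if b then Some c else None.

Definition halted P c : bool := if onth P (pc c) is Some Halt then true else false.

(* One step of a machine with s cells in each of its two memories and words of
   about log2 s bits: accessing an address >= s, or computing a word >= s, is
   an error (None). The registers occurring in a program are finitely many and
   fixed independently of the input, so they only use constant extra space;
   the word range keeps words from packing an unbounded amount of data. *)
Definition step s P c : option state :=
  match onth P (pc c) with
  | Some (WConst d k) => guard (k < s)%N (set_wreg c d k)
  | Some (WMove d a) => Some (set_wreg c d (wreg c a))
  | Some (WArith o d a b) =>
      let v := word_arith o (wreg c a) (wreg c b) in
      guard (v < s)%N (set_wreg c d v)
  | Some (WLoad d a) =>
      guard (wreg c a < s)%N (set_wreg c d (wmem c (wreg c a)))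
  | Some (WStore a b) =>
      guard (wreg c a < s)%N (set_wmem c (wreg c a) (wreg c b))
  | Some (RConst d z) => Some (set_rreg c d z%:~R)
  | Some (RMove d a) => Some (set_rreg c d (rreg c a))
  | Some (RArith o d a b) =>
      Some (set_rreg c d (real_arith o (rreg c a) (rreg c b)))
  | Some (RLoad d a) =>
      guard (wreg c a < s)%N (set_rreg c d (rmem c (wreg c a)))
  | Some (RStore a b) =>
      guard (wreg c a < s)%N (set_rmem c (wreg c a) (rreg c b))
  | Some (Jump l) => Some (goto c l)
  | Some (WJumpLe a b l) =>
      Some (goto c (if (wreg c a <= wreg c b)%N then l else (pc c).+1))
  | Some (RJumpLe a b l) =>
      Some (goto c (if rreg c a <= rreg c b then l else (pc c).+1))
  | Some Halt | None => None
  end.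

(* The state after exactly t steps, if there is no error or halt before. *)
Fixpoint run s P t c : option state :=
  if t is t'.+1 then obind (run s P t') (step s P c) else Some c.

Definition halts_within P t s c c' : Prop :=
  exists2 t', (t' <= t)%N & run s P t' c = Some c' /\ halted P c'.

(* Initially w_0 = n, r_0 = x, and the cells 0, ..., n-1 of the real memory
   hold a_1, ..., a_n; everything else is 0. *)
Definition initial_state (A : seq R) (x : R) : state :=
  State 0 [eta fun=> 0%N with 0%N |-> size A] [eta fun=> 0 with 0%N |-> x]
    (fun=> 0%N) (nth 0 A).

(* The answer is read from w_0. Time and space are bounded by functions of the
   length of the input sequence only. *)
Definition solves_insertion P (T S : nat -> nat) : Prop :=
  forall (A : seq R) (x : R), exists2 c,
    halts_within P (T (size A)) (S (size A)) (initial_state A x) c &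
    optimal_insertion_index A x (wreg c 0).

End Machine.

Definition is_linear_O (f : nat -> nat) : Prop :=
  exists C n0 : nat, forall n, (n0 <= n)%N -> (f n <= C * n)%N.

(* Main.v *)
Require Import Defs.
From mathcomp Require Import all_boot all_order all_algebra.
From mathcomp Require Import boolp reals.
From mathcomp Require Import zify lra.

(* Let L and V be the best suffix score and the value of a_1, ..., a_p, and let
   R and W be the best prefix score and the value of a_(p+1), ..., a_n. A
   subsequence of the sequence with x inserted at p either contains x or lies
   on one side of it, so the value after insertion is max(V, W, R + L + x).
   All the L, V are computed by Kadane's left-to-right scan and all the R, W by
   the symmetric right-to-left scan, in constant time per entry. *)

Set Implicit Arguments.
Unset Strict Implicit.
Unset Printing Implicit Defensive.

Import Order.TTheory GRing.Theory Num.Theory.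

Local Open Scope ring_scope.

(** * Best prefix and suffix scores, and their link to [value] *)

Section Scores.
Variable R : realFieldType.
Implicit Types (A B : seq R) (a c x : R) (p : nat).

(** Kadane's recurrence: a best prefix is empty or extends a best prefix of the tail. *)
Definition max_prefix A : R := foldr (fun a m => Num.max 0 (a + m)) 0 A.
Definition max_suffix A : R := max_prefix (rev A).

Lemma max_prefix_ge0 A : 0 <= max_prefix A.
Proof. by case: A => [|a A] //=; rewrite le_max lexx. Qed.

Lemma max_suffix_ge0 A : 0 <= max_suffix A.
Proof. exact: max_prefix_ge0. Qed.

Lemma score_cons a A : score (a :: A) = a + score A.
Proof. exact: big_cons. Qed.

Lemma score_rev A : score (rev A) = score A.
Proof. by apply: perm_big; rewrite perm_rev. Qed.

Lemma max_prefix_cat A B :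
  max_prefix (A ++ B) = Num.max (max_prefix A) (score A + max_prefix B).
Proof.
elim: A => [|a A IH] /=.
  by rewrite /score big_nil add0r (max_idPr (max_prefix_ge0 B)).
by rewrite IH score_cons addr_maxr maxA addrA.
Qed.

Lemma max_suffix_cons a A :
  max_suffix (a :: A) = Num.max (max_suffix A) (score (a :: A)).
Proof.
rewrite /max_suffix rev_cons -cats1 max_prefix_cat /= addr0 score_rev.
rewrite score_cons addr_maxr addr0 [score A + a]addrC.
(* All of [A] is one of its own suffixes, so the stray term [score A] is absorbed. *)
have : score A <= max_prefix (rev A).
  rewrite -score_rev -[X in max_prefix X]cats0 max_prefix_cat /= addr0.
  by rewrite le_max lexx orbT.
by move=> sA; rewrite maxA (max_idPl sA).
Qed.

Lemma max_suffix_rcons A a :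
  max_suffix (rcons A a) = Num.max 0 (max_suffix A + a).
Proof. by rewrite /max_suffix rev_rcons /= addrC. Qed.

(* Translation by c does not preserve the default element 0 of the iterated
   maximum, hence the outer maxima with 0. *)
Lemma bigmax_take c A :
  Num.max 0 (\big[Num.max/0]_(0 <= j < (size A).+1) (c + score (take j A)))
  = Num.max 0 (c + max_prefix A).
Proof.
elim: A c => [|a A IH] c.
  by rewrite big_nat1_id /= /score big_nil addr0 [Num.max c 0]maxC maxA maxxx.
rewrite big_ltn // big_add1 /= {1}/score big_nil addr0 maxCA.
under eq_bigr do rewrite score_cons addrA.
by rewrite IH addr_maxr addr0 maxCA addrA.
Qed.

Lemma value_nil : value [::] = 0 :> R.
Proof. by rewrite /value /= !big_nat1_id /score /= big_nil !maxxx. Qed.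

(** The row [i = 0] of the double maximum ranges over prefixes; the later rows are those of the
    tail. *)
Lemma value_cons a A :
  value (a :: A) = Num.max (max_prefix (a :: A)) (value A).
Proof.
rewrite /value big_ltn //; congr Num.max; last first.
  rewrite big_add1; apply: eq_bigr => i _; rewrite big_add1.
  by apply: eq_bigr => j _; rewrite /subsequence subSS.
rewrite -[RHS](max_idPr (max_prefix_ge0 _)) -[max_prefix _]add0r -bigmax_take.
under [in RHS]eq_bigr do rewrite add0r.
under [LHS]eq_bigr do rewrite /subsequence subn0 drop0.
by rewrite big_ltn //= /score big_nil maxA maxxx.
Qed.

Lemma value_ge0 A : 0 <= value A.
Proof.
by case: A => [|a A]; rewrite ?value_nil // value_cons le_max max_prefix_ge0.
Qed.

(** A subsequence lies in [A], lies in [B], or joins a suffix of [A] to a prefix of [B]. *)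
Lemma value_cat A B :
  value (A ++ B) =
  Num.max (Num.max (value A) (value B)) (max_suffix A + max_prefix B).
Proof.
have max_prefix_le_value C : max_prefix C <= value C.
  by case: C => [|a C]; rewrite ?value_nil // value_cons le_max lexx.
elim: A => [|a A IH].
  rewrite value_nil /max_suffix /= add0r (max_idPr (value_ge0 _)).
  by rewrite (max_idPl (max_prefix_le_value _)).
rewrite cat_cons !value_cons IH -cat_cons max_prefix_cat max_suffix_cons.
by rewrite addr_maxl; apply/le_anti; rewrite !ge_max !le_max !lexx !orbT.
Qed.

Lemma max_suffix_le_value A : max_suffix A <= value A.
Proof.
rewrite -{2}[A]cats0 value_cat /= addr0.
by rewrite le_max lexx orbT.
Qed.

Lemma value_rcons A a :
  value (rcons A a) = Num.max (max_suffix (rcons A a)) (value A).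
Proof.
have le0s := max_suffix_ge0 A; have lesv := max_suffix_le_value A.
rewrite -cats1 value_cat value_cons value_nil cats1 max_suffix_rcons /= addr0.
have leas : a <= max_suffix A + a by lra.
have lev : 0 <= value A by lra.
apply/le_anti; rewrite addr_maxr addr0 !ge_max !le_max !lexx.
by rewrite leas lesv lev !orbT.
Qed.

Lemma value_insertion A p x :
  value (insertion A p x) =
  Num.max (value (take p A)) (Num.max (value (drop p A))
    (max_prefix (drop p A) + max_suffix (take p A) + x)).
Proof.
have le0s := max_suffix_ge0 (take p A).
have lesv := max_suffix_le_value (take p A).
have le0v := value_ge0 (drop p A).
rewrite /insertion value_cat value_cons /= addr_maxr addr0.
set s := max_suffix _ in le0s lesv *; set m := max_prefix _.
have -> : s + (x + m) = m + s + x by lra.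
(* A subsequence starting at [x] is dominated, since [s] is nonnegative. *)
have les : x + m <= m + s + x by lra.
apply/le_anti; rewrite !ge_max !le_max !lexx.
by rewrite le0v lesv les !orbT.
Qed.

End Scores.

Local Close Scope ring_scope.

(* The backward pass, for p = n, ..., 0, stores the best prefix score and the
   value of [drop p A] in the cells p + n.+1 and p + 2 * n.+1 of the real
   memory. The forward pass maintains the best suffix score and the value of
   [take p A], and the best index so far.
   Word registers: w_0 = n, w_1 = p, w_2 = n.+1, w_3 = address, w_4 = 1,
   w_5 = best index. Real registers: r_0 = x, r_1 = 0, r_2 = best prefix or
   suffix score, r_3 = value of the scanned part, r_4 = current entry,
   r_5 = best value; r_6 and r_7 are temporary. *)
Definition insertion_program : program := [::
  (*  0 *) WConst 4 1;
  (*  1 *) WArith WAdd 2 0 4;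
  (*  2 *) WMove 1 0;
  (*  3 *) WArith WAdd 3 1 2;
  (*  4 *) RStore 3 2;
  (*  5 *) WArith WAdd 3 3 2;
  (*  6 *) RStore 3 3;
  (*  7 *) WJumpLe 4 1 9;
  (*  8 *) Jump 17;
  (*  9 *) WArith WSub 1 1 4;
  (* 10 *) RLoad 4 1;
  (* 11 *) RArith RAdd 2 4 2;
  (* 12 *) RJumpLe 1 2 14;
  (* 13 *) RMove 2 1;
  (* 14 *) RJumpLe 2 3 16;
  (* 15 *) RMove 3 2;
  (* 16 *) Jump 3;
  (* 17 *) RArith RAdd 5 2 0;
  (* 18 *) RJumpLe 3 5 20;
  (* 19 *) RMove 5 3;
  (* 20 *) RConst 2 0%R;
  (* 21 *) RConst 3 0%R;
  (* 22 *) WJumpLe 0 1 44;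
  (* 23 *) RLoad 4 1;
  (* 24 *) RArith RAdd 2 2 4;
  (* 25 *) RJumpLe 1 2 27;
  (* 26 *) RMove 2 1;
  (* 27 *) RJumpLe 2 3 29;
  (* 28 *) RMove 3 2;
  (* 29 *) WArith WAdd 1 1 4;
  (* 30 *) WArith WAdd 3 1 2;
  (* 31 *) RLoad 6 3;
  (* 32 *) WArith WAdd 3 3 2;
  (* 33 *) RLoad 7 3;
  (* 34 *) RArith RAdd 6 6 2;
  (* 35 *) RArith RAdd 6 6 0;
  (* 36 *) RJumpLe 7 6 38;
  (* 37 *) RMove 6 7;
  (* 38 *) RJumpLe 3 6 40;
  (* 39 *) RMove 6 3;
  (* 40 *) RJumpLe 5 6 22;
  (* 41 *) RMove 5 6;
  (* 42 *) WMove 5 1;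
  (* 43 *) Jump 22;
  (* 44 *) WMove 0 5;
  (* 45 *) Halt ].

(** * Composing executions with step bounds *)

Section Reachability.
Variables (R : realFieldType) (s : nat) (P : program).
Implicit Types (c : state R) (Q : state R -> Prop).

Definition reaches t c Q :=
  exists2 t', (t' <= t) & exists2 c', run s P t' c = Some c' & Q c'.

Lemma reaches_done t c Q : Q c -> reaches t c Q.
Proof. by move=> Qc; exists 0 => //; exists c. Qed.

Lemma reaches_step t c c1 Q :
  step s P c = Some c1 -> reaches t c1 Q -> reaches t.+1 c Q.
Proof.
move=> cc1 [t' t't [c' c1c' Qc']].
by exists t'.+1 => //; exists c'; rewrite //= cc1.
Qed.

Lemma run_add t1 t2 c : run s P (t1 + t2) c = obind (run s P t2) (run s P t1 c).
Proof. by elim: t1 c => //= t1 IH c; case: step. Qed.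

Lemma reaches_trans t1 t2 c Q1 Q :
  reaches t1 c Q1 -> (forall c', Q1 c' -> reaches t2 c' Q) ->
  reaches (t1 + t2) c Q.
Proof.
move=> [t1' le1 [c1 cc1 Qc1]] /(_ _ Qc1)[t2' le2 [c2 c1c2 Qc2]].
by exists (t1' + t2'); rewrite ?leq_add //; exists c2; rewrite ?run_add ?cc1.
Qed.

(** A conditional jump over a move computes a maximum in register [b]; one continuation then serves
    both branches. *)
Lemma reaches_max t (l a b : nat) w (r : nat -> R) wm rm Q : b != a ->
  onth P l = Some (RJumpLe a b l.+2) -> onth P l.+1 = Some (RMove b a) ->
  reaches t (State l.+2 w [eta r with b |-> Num.max (r a) (r b)] wm rm) Q ->
  reaches t.+2 (State l w r wm rm) Q.
Proof.
move=> nba Pl Pl1 reachQ; have step1 := @reaches_step t.+1 (State l w r wm rm).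
apply: step1; first by rewrite /step /= Pl.
case: leP reachQ => rab reachQ; last first.
  by apply: reaches_step reachQ; rewrite /step [pc _]/= Pl1.
have rK : ([eta r with b |-> r b] : nat -> R) = r.
  by apply: funext => k /=; case: eqP => [->|].
rewrite rK in reachQ.
by have [t' le [c' cc' Qc']] := reachQ; exists t'; [exact: leqW | exists c'].
Qed.

End Reachability.

(** * Loop invariants and step counts of the program *)

Section Correctness.
Variables (R : realFieldType) (A : seq R) (x : R).
Let n := size A.
(** Three blocks of [n.+1] cells: the input, the prefix scores and the values. *)
Let s := (3 * n + 3).

Record tables_from p (c : state R) : Prop := TablesFrom {
  w0_n : wreg c 0 = n;
  w2_n1 : wreg c 2 = n.+1;
  w4_1 : wreg c 4 = 1;
  r0_x : rreg c 0 = x;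
  r1_0 : rreg c 1 = 0%R;
  entries : forall i, (i < n) -> rmem c i = nth 0%R A i;
  prefixes : forall q, (p <= q <= n) ->
    rmem c (q + n.+1) = max_prefix (drop q A);
  values : forall q, (p <= q <= n) ->
    rmem c (q + n.+1 + n.+1) = value (drop q A)
}.

(** The scan is at [p] and the tables are filled from [q] on: [q] is [p.+1] before the store and [p]
    after it. *)
Record backward_invariant l p q (c : state R) : Prop := BackwardInvariant {
  b_le_n : (p <= n);
  b_pc : pc c = l;
  b_tables : tables_from q c;
  b_index : wreg c 1 = p;
  b_best : wreg c 5 = 0;
  b_prefix : rreg c 2 = max_prefix (drop p A);
  b_value : rreg c 3 = value (drop p A)
}.

Record forward_invariant p c : Prop := ForwardInvariant {
  f_le_n : (p <= n);
  f_pc : pc c = 22;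
  f_tables : tables_from 0 c;
  f_index : wreg c 1 = p;
  f_suffix : rreg c 2 = max_suffix (take p A);
  f_value : rreg c 3 = value (take p A);
  f_best_le : (wreg c 5 <= p);
  f_best_value : rreg c 5 = value (insertion A (wreg c 5) x);
  f_best : forall q, (q <= p) -> (rreg c 5 <= value (insertion A q x))%R
}.

Local Notation reaches := (reaches s insertion_program).

Ltac exec :=
  eapply reaches_step;
  [ by rewrite /step /= ?[guard _ _]ifT //; lia
  | rewrite /set_wreg /set_rreg /set_rmem /goto /= ].

Ltac exec_max :=
  eapply reaches_max; [ | reflexivity | reflexivity | ]; [by [] | rewrite /=].

Lemma backward_start :
  reaches 3 (initial_state A x) (backward_invariant 3 n n.+1).
Proof.
have sE : s = (3 * n + 3) by [].
do 3!exec; apply: reaches_done.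
have dropA : drop n A = [::] by apply: drop_size.
split; rewrite /= ?dropA ?value_nil //.
by split => //= [|q|q]; lia.
Qed.

Lemma backward_store p c :
  backward_invariant 3 p p.+1 c -> reaches 4 c (backward_invariant 7 p p).
Proof.
case: c => l w r wm rm [/= len -> [/= w0 w2 w4 r0 r1 Ar pr vl] w1 w5 r2 r3].
have sE : s = (3 * n + 3) by [].
do 4!exec; apply: reaches_done.
split => //=; split => //= q; rewrite ?w1 ?w2.
(* The three blocks are disjoint, so each store alters only cell [p] of its own table. *)
- move=> lt_qn; rewrite ifF; last by lia.
  by rewrite ifF ?Ar //; lia.
- move=> pqn; rewrite ifF; last by lia.
  by case: eqP => [|neq]; [move=> /addIn -> | apply: pr; lia].
- move=> pqn; case: eqP => [/addIn/addIn -> //|neq].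
  by rewrite ifF; [apply: vl; lia | lia].
Qed.

Lemma backward_step p c :
  backward_invariant 7 p.+1 p.+1 c ->
  reaches 9 c (backward_invariant 3 p p.+1).
Proof.
case: c => l w r wm rm [/= len -> [/= w0 w2 w4 r0 r1 Ar pr vl] w1 w5 r2 r3].
have sE : s = (3 * n + 3) by [].
apply: reaches_step; first by rewrite /step /= w4 w1 /goto /=.
do 3!exec; do 2!exec_max; exec; apply: reaches_done.
have dropA : drop p A = nth 0%R A p :: drop p.+1 A by apply: drop_nth.
have w1p : (w 1 - w 4) = p by lia.
split => //=; try lia; rewrite w1p Ar // r1 r2 ?r3 dropA //.
by rewrite value_cons.
Qed.

Lemma backward_exit c :
  backward_invariant 7 0 0 c -> reaches 2 c (backward_invariant 17 0 0).
Proof.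
case: c => l w r wm rm [/= len -> [/= w0 w2 w4 r0 r1 Ar pr vl] w1 w5 r2 r3].
apply: reaches_step; first by rewrite /step /= w4 w1 /goto /=.
by exec; apply: reaches_done; split.
Qed.

(** A round takes 4 steps to store and 9 to advance; the last store and the exit take 4 + 2. *)
Lemma backward_loop p c :
  backward_invariant 3 p p.+1 c ->
  reaches (13 * p + 6) c (backward_invariant 17 0 0).
Proof.
elim: p c => [|p IH] c inv.
  exact: reaches_trans (backward_store inv) backward_exit.
rewrite (_ : 13 * p.+1 + 6 = 4 + (9 + (13 * p + 6))); last by lia.
apply: reaches_trans (backward_store inv) _ => c1 inv1.
exact: reaches_trans (backward_step inv1) IH.
Qed.

Lemma forward_start c :
  backward_invariant 17 0 0 c -> reaches 5 c (forward_invariant 0).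
Proof.
case: c => l w r wm rm [/= len -> [/= w0 w2 w4 r0 r1 Ar pr vl] w1 w5 r2 r3].
exec; exec_max; do 2!exec; apply: reaches_done.
have best0 : Num.max (r 3) (r 2 + r 0)%R = value (insertion A 0 x).
  rewrite value_insertion take0 /= /max_suffix /= value_nil addr0 r0 r2 r3.
  by rewrite maxA (max_idPr (value_ge0 _)).
split; rewrite /= ?w5 ?take0 ?value_nil //.
by move=> q; rewrite leqn0 => /eqP ->; rewrite best0.
Qed.

Lemma forward_step p c : (p < n) ->
  forward_invariant p c -> reaches 22 c (forward_invariant p.+1).
Proof.
move=> lt_pn; case: c => l w r wm rm.
case=> [/= _ -> [/= w0 w2 w4 r0 r1 Ar pr vl] w1 r2 r3 w5 r5 best].
have sE : s = (3 * n + 3) by [].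
apply: reaches_step.
  by rewrite /step /= w0 w1 leqNgt lt_pn /goto /=.
do 2!exec; do 2!exec_max; do 7!exec; do 2!exec_max.
have takeA : take p.+1 A = rcons (take p A) (nth 0%R A p) by apply: take_nth.
have suffixA : Num.max (r 1) (r 2 + rm (w 1))%R = max_suffix (take p.+1 A).
  by rewrite takeA max_suffix_rcons r1 r2 w1 Ar.
rewrite suffixA.
have valueA : Num.max (max_suffix (take p.+1 A)) (r 3) = value (take p.+1 A).
  by rewrite r3 takeA value_rcons.
rewrite valueA.
have w1p : (w 1 + w 4) = p.+1 by lia.
(* [r_6] holds the right-hand side of [value_insertion] at [p.+1]. *)
rewrite w1p w2 vl // pr // r0 -value_insertion.
(* Ties keep the old best; otherwise [p.+1] strictly beats all earlier indices. *)
case: (leP (r 5) (value (insertion A p.+1 x))) => le5.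
  apply: reaches_step; first by rewrite /step /= le5 /goto /=.
  apply: reaches_done; split => //=; first exact: leqW.
  by move=> q; rewrite leq_eqVlt => /predU1P[-> //|]; apply: best.
apply: reaches_step; first by rewrite /step /= leNgt le5 /goto /=.
do 3!exec; apply: reaches_done; split=> //=.
move=> q; rewrite leq_eqVlt => /predU1P[-> //|le_qp].
exact: le_trans (ltW le5) (best q le_qp).
Qed.

Lemma forward_loop k p c : (p + k = n) ->
  forward_invariant p c -> reaches (22 * k) c (forward_invariant n).
Proof.
elim: k p c => [|k IH] p c pk inv.
  by rewrite -pk addn0 in inv *; apply: reaches_done.
rewrite mulnS; apply: (reaches_trans (forward_step _ inv)); first by lia.
by move=> c1; apply: IH; lia.
Qed.

Lemma forward_exit c : forward_invariant n c ->
  reaches 2 c (fun c' => halted insertion_program c' /\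
    optimal_insertion_index A x (wreg c' 0)).
Proof.
case: c => l w r wm rm.
case=> [/= _ -> [/= w0 w2 w4 r0 r1 Ar pr vl] w1 r2 r3 w5 r5 best].
apply: reaches_step.
  by rewrite /step /= w0 w1 leqnn /goto /=.
exec; apply: reaches_done; split => //; split => // q.
by rewrite -r5; apply: best.
Qed.

Lemma insertion_program_correct :
  reaches (35 * n + 16) (initial_state A x) (fun c =>
    halted insertion_program c /\ optimal_insertion_index A x (wreg c 0)).
Proof.
rewrite (_ : 35 * n + 16 = 3 + (13 * n + 6 + (5 + (22 * n + 2)))).
2: by lia.
apply: reaches_trans backward_start _ => c1 inv1.
apply: reaches_trans (backward_loop inv1) _ => c2 inv2.
apply: reaches_trans (forward_start inv2) _ => c3 inv3.
exact: reaches_trans (forward_loop (add0n n) inv3) forward_exit.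
Qed.

End Correctness.

Theorem theorem1 (R : realType) :
  exists (P : program) (T S : nat -> nat),
    [/\ is_linear_O T, is_linear_O S & solves_insertion R P T S].
Proof.
exists insertion_program, (fun n => 35 * n + 16), (fun n => 3 * n + 3).
split=> [||A x].
(* For [n >= 1] the constant 16 is at most [16 * n], and 35 + 16 = 51; likewise 3 + 3 = 6 for
   space. *)
- by exists 51, 1 => n; lia.
- by exists 6, 1 => n; lia.
have [t le_t [c run_c [halted_c opt_c]]] := insertion_program_correct A x.
by exists c => //; exists t.
Qed.
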